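(* Let $X$ be a real inner product space and $F:X\to\mathbb R$ a locally Lipschitz convex function. Then, for given $x,y\in X$, the following statements are equivalent: (1) $\nabla F(x)\cap\nabla F(y)=\nabla F(tx+(1-t)y)$ whenever $0<t<1$; (1') $\nabla F(x)\cap\nabla F(y)=\nabla F(tx+(1-t)y)$ for some $0<t<1$; (2) $\nabla F(x)\cap\nabla F(y)\ne\varnothing$; (3) $tF(x)+(1-t)F(y)=F(tx+(1-t)y)$ whenever $0<t<1$; (3') $tF(x)+(1-t)F(y)=F(tx+(1-t)y)$ for some $0<t<1$.
   Context: $\nabla F(x)$ is the subdifferential $\{u:\langle u,x'-x\rangle\le F(x')-F(x)\ \forall x'\in X\}$ of the convex function $F$ at $x$.
   Formalization: Subgradients u are taken in the continuous dual of X for every inner product space X; for u in X with the inner product, X is also assumed complete, since otherwise ∇F can be empty everywhere and (2) fails while (1), (1'), (3) and (3') hold. *)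

(* Defs.v *)
From HB Require Import structures.
From mathcomp Require Import all_boot all_order all_algebra sesquilinear.
From mathcomp Require Import all_classical all_reals all_analysis.

Set Implicit Arguments.
Unset Strict Implicit.
Unset Printing Implicit Defensive.

Import Order.TTheory GRing.Theory Num.Theory.
Import numFieldNormedType.Exports.

Local Open Scope classical_set_scope.
Local Open Scope ring_scope.

(* [locally [lipschitz F x | x in setT]] is not used: it asks for a Lipschitz
   bound near every pair (a, b), not only near the diagonal. *)
Definition locally_lipschitz (R : realType) (X : normedModType R)
    (F : X -> R) : Prop :=
  forall a : X, exists2 A : set X, nbhs a A & [lipschitz (F x : R^o) | x in A].

(* The statement of completeness in the library's Complete structure, as a
   predicate on a space not assumed to carry that structure. *)
Definition complete_space (R : realType) (X : normedModType R) : Prop :=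
  forall G : set_system X, ProperFilter G -> cauchy G -> cvg G.

Definition dual (R : realType) (X : normedModType R) : Type :=
  {u : {scalar X} | continuous (u : X -> R)}.

Definition dual_pairing (R : realType) (X : normedModType R)
    (u : dual X) (v : X) : R := sval u v.

(* The space U in which the subgradients live is a parameter: it is the
   topological dual of X, with its evaluation pairing, or X itself, with its
   inner product.  By the Riesz representation theorem the two agree when X is
   complete.  When X is not complete the second one may be empty even if F is
   linear and continuous, namely if F is not an inner product with a vector
   of X. *)
Definition subdifferential (R : realType) (X : normedModType R) (U : Type)
    (pairing : U -> X -> R) (F : X -> R) (x : X) : set U :=
  [set u | forall x' : X, pairing u (x' - x) <= F x' - F x].

(* Main.v *)
Require Import Defs.
From HB Require Import structures.
From mathcomp Require Import all_boot all_order all_algebra sesquilinear.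
From mathcomp Require Import all_classical all_reals all_analysis.
From mathcomp Require Import ring lra.

Set Implicit Arguments.
Unset Strict Implicit.
Unset Printing Implicit Defensive.

Import Order.TTheory GRing.Theory Num.Theory.
Import numFieldNormedType.Exports.

Local Open Scope classical_set_scope.
Local Open Scope ring_scope.

(** If a subgradient u is common to x and y, the affine minorants of F with
slope u that touch F at x and at y are the same function, so F is squeezed
between it and the chord on the segment [x, y]; hence F is affine there.
Conversely, suppose that F agrees with its chord at one interior point z.  A
subgradient at z gives an affine minorant of F that touches the chord at z and
stays below it at both ends; an affine function cannot do that unless it
touches at both ends too, so the subgradient is common to x and y.  Thus
equality at one t gives an element common to dF x and dF y, this gives equality
at all t, and equality at t gives dF x `&` dF y = dF z.  All of this is
algebra ([subdifferential_tfae]), once it is known that F has a subgradient at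
every point.

The existence of a subgradient at x uses the Euclidean structure rather than
the extension of functionals.  Look for the direction of steepest descent:
minimise r (F (x + v / r) - F x) + |v|^2 / 2 over r > 0 and v.  The first term
is the perspective of F, which is sublinear in the pair (r, v)
([perspectiveD], [perspectiveZ]), and it is at least - L |v| because a convex
function that is Lipschitz near x decreases globally at most at that rate
([convex_lipschitz_minorant]); so the infimum is finite.  By the parallelogram
identity the v-components of a minimising sequence form a Cauchy sequence
([near_minimizers_close]), and adding a small multiple of (1, h) to a
near-minimiser shows that - v is nearly a subgradient
([near_minimizer_subgradient]).  In a complete space the limit of - v is a
subgradient.  In general only the functionals h |-> ip (- v) h need converge,
and their limit is a subgradient in the dual. *)

(** * Convex and locally Lipschitz functions *)

Lemma convex_functionT_le (R : realType) (X : lmodType R) (F : X -> R) :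
  convex_function setT F -> forall (t : R) (a b : X), 0 <= t <= 1 ->
  F (t *: a + (1 - t) *: b) <= t * F a + (1 - t) * F b.
Proof.
move=> cF t a b t01.
have := cF (Itv01 (andP t01).1 (andP t01).2) a b.
by rewrite !in_setT; apply.
Qed.

Lemma locally_lipschitz_at (R : realType) (X : normedModType R) (F : X -> R) :
  locally_lipschitz F -> forall x, exists2 L : R, 0 < L &
  \forall h \near (0 : X), `|F (x + h) - F x| <= L * `|h|.
Proof.
move=> lF x; have [A Ax /pinfty_ex_gt0[L L0 LA]] := lF x.
exists L => //; have /nbhs0P : \forall z \near x, `|F z - F x| <= L * `|z - x|.
  by near=> z; apply: (LA (z, x)); split => /=; [near: z|apply: nbhs_singleton].
by apply: filterS => h; rewrite [x + h - x]addrAC subrr add0r.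
Unshelve. all: by end_near. Qed.

(** By convexity the slope of F from x in the direction h is smallest near x,
where the Lipschitz bound applies. *)
Lemma convex_lipschitz_minorant (R : realType) (X : normedModType R)
    (F : X -> R) (x : X) (L : R) : convex_function setT F ->
  (\forall h \near (0 : X), `|F (x + h) - F x| <= L * `|h|) ->
  forall h, - (L * `|h|) <= F (x + h) - F x.
Proof.
move=> cF /nbhs_norm0P[d /= d0 Ld] h.
near (0 : R)^'+ => t.
have t0 : 0 < t by [].
have t1 : t <= 1 by near: t; exact: nbhs_right_le.
have td : `|t *: h| < d.
  have h1 : 0 < `|h| + 1 by rewrite ltr_wpDl.
  rewrite normrZ gtr0_norm//; have : t < d / (`|h| + 1).
    by near: t; apply: nbhs_right_lt; rewrite divr_gt0.
  by rewrite ltr_pdivlMr// mulrDr mulr1; apply: le_lt_trans; rewrite lerDl ltW.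
have := Ld _ td; rewrite /= normrZ gtr0_norm// ler_norml => /andP[Lt _].
have := convex_functionT_le cF (x + h) x (_ : 0 <= t <= 1).
rewrite t1 ltW// => /(_ isT).
rewrite scalerDr addrAC -scalerDl addrC (_ : t + (1 - t) = 1); last by ring.
rewrite scale1r [_ + x]addrC => H.
by rewrite -(ler_pM2l t0); lra.
Unshelve. all: by end_near. Qed.

(** * Real inner products *)

Section InnerProduct.
Variables (R : realType) (X : normedModType R) (ip : {dot X for idfun}).
Hypothesis norm_ip : forall v : X, ip v v = `|v| ^+ 2.
Implicit Types u v : X.

Lemma ipC u v : ip u v = ip v u.
Proof. by rewrite hermC /= expr0 mul1r. Qed.

Lemma sqr_normD u v : `|u + v| ^+ 2 = `|u| ^+ 2 + 2 * ip u v + `|v| ^+ 2.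
Proof. rewrite -!norm_ip linearDr/= !linearDl/= (ipC v u); ring. Qed.

Lemma parallelogram u v :
  `|u - v| ^+ 2 = 2 * `|u| ^+ 2 + 2 * `|v| ^+ 2 - `|u + v| ^+ 2.
Proof. by rewrite !sqr_normD linearNr normrN /=; ring. Qed.

(** The Cauchy-Schwarz inequality is the triangle inequality squared, the norm
being given. *)
Lemma ip_le_norm u v : `|ip u v| <= `|u| * `|v|.
Proof.
have H w : ip w v <= `|w| * `|v|.
  have : `|w + v| ^+ 2 <= (`|w| + `|v|) ^+ 2.
    by rewrite lerXn2r ?nnegrE ?addr_ge0 ?ler_normD.
  by rewrite sqr_normD sqrrD; lra.
rewrite ler_norml H andbT; have := H (- u).
by rewrite linearNl /= normrN; lra.
Qed.

Lemma ip_cvg (a : X^nat) (l h : X) :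
  a @ \oo --> l -> (fun n => ip (a n) h) @ \oo --> ip l h.
Proof.
move=> al; apply/cvgrPdist_le => e e0.
have h1 : 0 < `|h| + 1 by rewrite ltr_wpDl.
have /cvgrPdist_le/(_ _ (divr_gt0 e0 h1)) := al.
apply: filterS => n; rewrite ler_pdivlMr// => H.
rewrite -linearBl/=; apply: le_trans (ip_le_norm _ _) _.
by have := normr_ge0 (l - a n); nra.
Qed.

End InnerProduct.

(** * The perspective of a convex function *)

Section Perspective.
Variables (R : realType) (X : lmodType R) (F : X -> R) (x : X).
(** The scale r multiplies, so r = 1 is the increment of F at x and r going to
infinity gives the directional derivative.  Keeping r as a variable to minimise
over makes it unnecessary to form that derivative. *)
Definition perspective (r : R) (v : X) := r * (F (x + r^-1 *: v) - F x).

Lemma perspective1 v : perspective 1 v = F (x + v) - F x.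
Proof. by rewrite /perspective mul1r invr1 scale1r. Qed.

Lemma perspectiveZ t r v : 0 < t -> 0 < r ->
  perspective (t * r) (t *: v) = t * perspective r v.
Proof.
move=> t0 r0; rewrite /perspective scalerA.
have -> : (t * r)^-1 * t = r^-1 by field; rewrite !gt_eqF.
by rewrite mulrA.
Qed.

Hypothesis F_convex : convex_function setT F.

(** The point on the left is the convex combination of the two points on the
right with weights r / (r + r') and r' / (r + r'). *)
Lemma perspectiveD r r' v v' : 0 < r -> 0 < r' ->
  perspective (r + r') (v + v') <= perspective r v + perspective r' v'.
Proof.
move=> r0 r'0; rewrite /perspective.
have s0 : 0 < r + r' by rewrite addr_gt0.
have t01 : 0 <= r / (r + r') <= 1.
  by rewrite divr_ge0 ?(ltW r0) ?(ltW s0)//= ler_pdivrMr// mul1r lerDl ltW.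
have := convex_functionT_le F_convex (x + r^-1 *: v) (x + r'^-1 *: v') t01.
have E : 1 - r / (r + r') = r' / (r + r') by field; rewrite gt_eqF.
rewrite E !scalerDr addrACA -scalerDl -mulrDl mulfV ?gt_eqF// scale1r !scalerA.
have -> : r / (r + r') / r = (r + r')^-1 by field; rewrite !gt_eqF.
have -> : r' / (r + r') / r' = (r + r')^-1 by field; rewrite !gt_eqF.
rewrite -(ler_pM2l s0); set a := F _; set b := F _; set c := F _.
by rewrite mulrDr !mulrA ![(r + r') * _ / _]mulrAC mulfV ?gt_eqF//; lra.
Qed.
End Perspective.

(** * Approximate subgradients by minimisation *)

Section Minimization.
Variables (R : realType) (X : normedModType R) (ip : {dot X for idfun}).
Hypothesis norm_ip : forall v : X, ip v v = `|v| ^+ 2.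
Variables (F : X -> R) (x : X).
Hypothesis F_convex : convex_function setT F.
Implicit Types (r e m L : R) (u v h : X).

Definition descent_cost r v := perspective F x r v + `|v| ^+ 2 / 2.

Lemma descent_cost_inf L : (forall h, - (L * `|h|) <= F (x + h) - F x) ->
  exists2 m, forall r v, 0 < r -> m <= descent_cost r v &
    forall e, 0 < e -> exists r v, 0 < r /\ descent_cost r v <= m + e.
Proof.
move=> FL; pose C := [set c | exists r v, 0 < r /\ descent_cost r v = c].
have Cb : has_lbound C.
  exists (- (L ^+ 2 / 2)) => _ [r [v [r0 <-]]].
  have : - (L * `|v|) <= perspective F x r v.
    have := ler_wpM2l (ltW r0) (FL (r^-1 *: v)).
    rewrite normrZ gtr0_norm ?invr_gt0//.
    by rewrite mulrN mulrCA mulVKf ?gt_eqF.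
  (* - L s + s^2 / 2 is smallest at s = L. *)
  by rewrite /descent_cost; have := sqr_ge0 (`|v| - L); lra.
have C0 : C !=set0 by exists (descent_cost 1 0), 1, 0.
exists (inf C) => [r v r0|e e0].
  by apply: ge_inf => //; exists r, v.
have [_ [r [v [r0 <-]]] /ltW Ce] := inf_adherent e0 (conj C0 Cb).
by exists r, v.
Qed.

(** The perspective is midpoint convex and the squared norm is strongly convex,
so two near-minimisers that are far apart would have a midpoint of cost below
the infimum.  The error is measured as a square because the resulting distance
is then linear in it. *)
Lemma near_minimizers_close m r r' v v' e e' :
  (forall r v, 0 < r -> m <= descent_cost r v) ->
  0 < r -> 0 < r' -> 0 <= e -> 0 <= e' ->
  descent_cost r v <= m + e ^+ 2 -> descent_cost r' v' <= m + e' ^+ 2 ->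
  `|v - v'| <= 2 * (e + e').
Proof.
move=> mQ r0 r'0 e0 e'0 Qe Qe'.
have half0 : 0 < (2^-1 : R) by lra.
have s0 : 0 < r + r' by rewrite addr_gt0.
have := mQ (2^-1 * (r + r')) (2^-1 *: (v + v')) (mulr_gt0 half0 s0).
move: Qe Qe'; rewrite /descent_cost perspectiveZ// normrZ gtr0_norm// exprMn.
have := perspectiveD x F_convex v v' r0 r'0.
have := parallelogram norm_ip v v' => P D Qe Qe' mQ'.
rewrite -(@ler_pXn2r _ 2) ?nnegrE ?mulr_ge0 ?addr_ge0// P.
have := mulr_ge0 e0 e'0; nra.
Qed.

(** First-order optimality at a near-minimiser: the competitor
(r + e, v + e h) has a cost that exceeds that of (r, v) by at most
e (F (x + h) - F x) + e (ip v h) + e^2 |h|^2 / 2.  A step of length e when the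
cost is within e^2 of the infimum leaves an error of order e. *)
Lemma near_minimizer_subgradient m r v e h :
  (forall r v, 0 < r -> m <= descent_cost r v) ->
  0 < r -> 0 < e -> descent_cost r v <= m + e ^+ 2 ->
  ip (- v) h <= F (x + h) - F x + e * (1 + `|h| ^+ 2 / 2).
Proof.
move=> mQ r0 e0 Qe; rewrite linearNl/=.
have := mQ (r + e) (v + e *: h) _; rewrite addr_gt0// => /(_ isT).
have := perspectiveD x F_convex v (e *: h) r0 e0.
rewrite -[X in perspective F x X (e *: h)]mulr1 perspectiveZ// perspective1.
move: Qe; rewrite /descent_cost (sqr_normD norm_ip) linearZr_LR/=.
rewrite normrZ gtr0_norm// exprMn => Qe D M.
by rewrite -(ler_pM2l e0); lra.
Qed.

(** The direction of steepest descent is opposite to the subgradient of least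
norm, hence the terms are the negatives of near-minimisers. *)
Lemma approximate_subgradients L :
  (forall h, - (L * `|h|) <= F (x + h) - F x) ->
  exists2 a : X^nat,
    forall n k, `|a n - a k| <= 2 * (harmonic n + harmonic k) &
    forall n h,
      ip (a n) h <= F (x + h) - F x + harmonic n * (1 + `|h| ^+ 2 / 2).
Proof.
move=> /descent_cost_inf[m mQ mQe].
have /choice[a Ha] n : exists a : X, exists2 r, 0 < r &
    descent_cost r (- a) <= m + harmonic n ^+ 2.
  have [r [v [r0 Q]]] := mQe (harmonic n ^+ 2) (exprn_gt0 _ (harmonic_gt0 n)).
  by exists (- v), r; rewrite ?opprK.
exists a => [n k|n h].
  have [[r r0 Q] [s s0 Q']] := (Ha n, Ha k).
  rewrite distrC -[a k]opprK addrC.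
  exact: (near_minimizers_close mQ r0 s0 (harmonic_ge0 n) (harmonic_ge0 k)).
have [r r0 Q] := Ha n; rewrite -[a n]opprK.
exact: (near_minimizer_subgradient h mQ r0 (harmonic_gt0 n) Q).
Qed.
End Minimization.

(** * Limits of approximate subgradients *)

Lemma cauchy_harmonic (R : realType) (V : normedModType R) (a : V^nat) (C : R) :
  (forall n k, `|a n - a k| <= C * (harmonic n + harmonic k)) ->
  cauchy (a @ \oo).
Proof.
move=> aC; apply: cauchy_exP => e e0.
have D0 : 0 < `|C| + 1 by rewrite ltr_wpDl.
have small : \forall n \near \oo, (harmonic n : R) < e / 2 / (`|C| + 1).
  have := @cvgr_lt _ _ _ _ _ _ (@cvg_harmonic R) (e / 2 / (`|C| + 1)).
  by apply; rewrite !divr_gt0.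
near \oo => N.
exists (a N); suff : \forall n \near \oo, ball (a N) e (a n) by [].
near=> n; rewrite -ball_normE /=.
apply: le_lt_trans (aC _ _) _.
have hN : (harmonic N : R) < e / 2 / (`|C| + 1) by near: N.
have hn : (harmonic n : R) < e / 2 / (`|C| + 1) by near: n.
have hN0 := @harmonic_ge0 R N; have hn0 := @harmonic_ge0 R n.
rewrite ltr_pdivlMr// in hN; rewrite ltr_pdivlMr// in hn.
by have := ler_norm C; nra.
Unshelve. all: by end_near. Qed.

Lemma le_lim_harmonic (R : realType) (f : R^nat) (l c d : R) :
  f @ \oo --> l -> (forall n, f n <= c + harmonic n * d) -> l <= c.
Proof.
move=> fl fc; have : (fun n => c + harmonic n * d) @ \oo --> c + 0 * d.
  apply: cvgD; first exact: cvg_cst.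
  by apply: cvgMl; exact: cvg_harmonic.
rewrite mul0r addr0 => gc; apply: (ler_cvg_to fl gc); exact: nearW.
Qed.

Section Existence.
Variables (R : realType) (X : normedModType R) (ip : {dot X for idfun}).
Hypothesis norm_ip : forall v : X, ip v v = `|v| ^+ 2.
Variable F : X -> R.
Hypothesis F_lip : locally_lipschitz F.
Hypothesis F_convex : convex_function setT F.

Lemma complete_subdifferential_neq0 (x : X) : complete_space X ->
  subdifferential ip F x !=set0.
Proof.
move=> cX; have [L _ /(convex_lipschitz_minorant F_convex) FL] :=
  locally_lipschitz_at F_lip x.
have [a aC aF] := approximate_subgradients norm_ip F_convex FL.
have al : a @ \oo --> lim (a @ \oo) by apply: cX (cauchy_harmonic aC).
exists (lim (a @ \oo)) => p; apply: le_lim_harmonic (ip_cvg norm_ip al) _ => n.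
by have := aF n (p - x); rewrite [x + _]addrC subrK; apply.
Qed.

(** Without completeness the approximate subgradients may have no limit in X,
but their pairing with each fixed h is a Cauchy sequence of reals.  The limit
functional is continuous because the subgradient inequality bounds it by the
local Lipschitz constant of F. *)
Lemma dual_subdifferential_neq0 (x : X) :
  subdifferential (@dual_pairing R X) F x !=set0.
Proof.
have [L L0 FLx] := locally_lipschitz_at F_lip x.
have FL := convex_lipschitz_minorant F_convex FLx.
have [a aC aF] := approximate_subgradients norm_ip F_convex FL.
have acvg h : cvgn (fun n => ip (a n) h).
  apply/cauchy_cvgP; apply: (@cauchy_harmonic _ _ _ (2 * `|h|)) => n k.
  rewrite -linearBl/=; apply: le_trans (ip_le_norm norm_ip _ _) _.
  by rewrite mulrAC ler_wpM2r.
pose u h : R := limn (fun n => ip (a n) h).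
have uF h : u h <= F (x + h) - F x.
  by apply: le_lim_harmonic (acvg h) _ => n; exact: aF.
have ulin : linear_for *%R u.
  move=> t v w; apply/cvg_lim => //.
  under eq_fun do rewrite linearDr/= linearZr_LR/=.
  by apply: cvgD; [apply: cvgMr|]; exact: acvg.
pose u' : {scalar X} := HB.pack u (GRing.isLinear.Build R X R *%R u ulin).
have uc : continuous (u' : X -> R).
  apply: (@bounded_linear_continuous R X R^o).
  have /nbhs_norm0P[d /= d0 Ld] := FLx.
  apply/ex_bound; exists L; apply/nbhs_norm0P; exists (Num.min d 1).
    by rewrite /= lt_min d0 ltr01.
  move=> h /=; rewrite lt_min => /andP[hd h1].
  have ub w : `|w| < d -> `|w| < 1 -> u w <= L.
    move=> wd w1; apply: le_trans (uF w) _; apply: le_trans (ler_norm _) _.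
    by apply: le_trans (Ld _ wd) _; rewrite ler_piMr ?ltW.
  rewrite ler_norml ub// andbT lerNl -(linearN u').
  by apply: ub; rewrite normrN.
exists (exist _ u' uc) => p; rewrite /dual_pairing/=.
by have := uF (p - x); rewrite [x + _]addrC subrK.
Qed.
End Existence.

(** * Subdifferentials at the points of a segment *)

Section SubdifferentialOnSegments.
Variables (R : realType) (X : normedModType R) (U : Type).
Variables (pairing : U -> X -> R) (F : X -> R).
Hypothesis pairing_linear : forall u, scalar (pairing u).
Hypothesis F_convex : convex_function setT F.
Local Notation dF := (subdifferential pairing F).

Lemma pairing0 u : pairing u 0 = 0.
Proof. by have := pairing_linear u 1 0 0; rewrite scaler0 addr0; lra. Qed.

Lemma pairingD u v w : pairing u (v + w) = pairing u v + pairing u w.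
Proof. by have := pairing_linear u 1 v w; rewrite scale1r mul1r. Qed.

Lemma pairingZ u t v : pairing u (t *: v) = t * pairing u v.
Proof. by have := pairing_linear u t v 0; rewrite pairing0 !addr0. Qed.

Lemma pairingN u v : pairing u (- v) = - pairing u v.
Proof. by rewrite -scaleN1r pairingZ mulN1r. Qed.

Definition pairingE := (pairingN, pairingD, pairingZ).

(** An element of dF z, z being the point of the segment, satisfies one
inequality towards x and one towards y.  Their convex combination with weights
t and 1 - t is an equality, so both are equalities, and the affine minorant that
touches F at z touches it at x and y. *)
Lemma subdifferential_affine (t : R) (x y : X) : 0 < t < 1 ->
  t * F x + (1 - t) * F y = F (t *: x + (1 - t) *: y) ->
  dF x `&` dF y = dF (t *: x + (1 - t) *: y).
Proof.
move=> /andP[t0]; rewrite -subr_gt0 => t1 E; apply/seteqP; split=> u.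
  move=> [ux uy] p.
  have := ler_wpM2l (ltW t0) (ux p); have := ler_wpM2l (ltW t1) (uy p).
  by rewrite -E !pairingE; lra.
move=> uz; have := uz x; have := uz y; rewrite -E !pairingE => Hy Hx.
have Ey : pairing u y = pairing u x - F x + F y.
  apply/eqP; rewrite eq_le; apply/andP; split.
    by rewrite -(ler_pM2l t0); lra.
  by rewrite -(ler_pM2l t1); lra.
by split=> p; have := uz p; rewrite -E !pairingE Ey; lra.
Qed.

(** The lower bound for F at the point of the segment is the convex combination
of the two subgradient inequalities, in which the linear terms cancel; the
upper bound is convexity. *)
Lemma affine_of_common_subgradient (t : R) (x y : X) : 0 < t < 1 ->
  dF x `&` dF y !=set0 ->
  t * F x + (1 - t) * F y = F (t *: x + (1 - t) *: y).
Proof.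
move=> /andP[t0]; rewrite -subr_gt0 => t1 [u [ux uy]].
apply/eqP; rewrite eq_le; apply/andP; split.
  have := ler_wpM2l (ltW t0) (ux (t *: x + (1 - t) *: y)).
  have := ler_wpM2l (ltW t1) (uy (t *: x + (1 - t) *: y)).
  by rewrite !pairingE; lra.
by apply: convex_functionT_le => //; rewrite !ltW // -subr_gt0.
Qed.

(** The space of subgradients enters only through linearity of the pairing and
nonemptiness of the subdifferentials, so one statement serves both the dual and
the space itself. *)
Lemma subdifferential_tfae (x y : X) : (forall z, dF z !=set0) ->
  [<-> forall t : R, 0 < t < 1 ->
         dF x `&` dF y = dF (t *: x + (1 - t) *: y);
       exists2 t : R, 0 < t < 1 &
         dF x `&` dF y = dF (t *: x + (1 - t) *: y);
       dF x `&` dF y <> set0;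
       forall t : R, 0 < t < 1 ->
         t * F x + (1 - t) * F y = F (t *: x + (1 - t) *: y);
       exists2 t : R, 0 < t < 1 &
         t * F x + (1 - t) * F y = F (t *: x + (1 - t) *: y)].
Proof.
have half : 0 < (2^-1 : R) < 1 by lra.
move=> dF0; tfae.
- by move=> H; exists 2^-1 => //; apply: H.
- by move=> [t _ ->]; apply/eqP/set0P/dF0.
- by move=> /eqP/set0P N t t01; apply: affine_of_common_subgradient.
- by move=> H; exists 2^-1 => //; apply: H.
(* Equality spreads from t to s through a subgradient at the point of t, which
  is common to x and y. *)
- move=> [t t01 E] s s01; apply: subdifferential_affine => //.
  apply: affine_of_common_subgradient => //.
  by rewrite (subdifferential_affine t01 E).
Qed.
End SubdifferentialOnSegments.

Theorem proposition2p5 (R : realType) (X : normedModType R)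
    (ip : {dot X for idfun})
    (norm_ip : forall v : X, ip v v = `|v| ^+ 2)
    (F : X -> R)
    (F_lip : locally_lipschitz F)
    (F_convex : convex_function setT F)
    (x y : X) :
  (let dF : X -> set (dual X) := subdifferential (@dual_pairing R X) F in
   [<-> forall t : R, 0 < t < 1 ->
          dF x `&` dF y = dF (t *: x + (1 - t) *: y);
        exists2 t : R, 0 < t < 1 &
          dF x `&` dF y = dF (t *: x + (1 - t) *: y);
        dF x `&` dF y <> set0;
        forall t : R, 0 < t < 1 ->
          t * F x + (1 - t) * F y = F (t *: x + (1 - t) *: y);
        exists2 t : R, 0 < t < 1 &
          t * F x + (1 - t) * F y = F (t *: x + (1 - t) *: y)])
  /\
  (complete_space X ->
   let dF : X -> set X := subdifferential ip F in
   [<-> forall t : R, 0 < t < 1 ->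
          dF x `&` dF y = dF (t *: x + (1 - t) *: y);
        exists2 t : R, 0 < t < 1 &
          dF x `&` dF y = dF (t *: x + (1 - t) *: y);
        dF x `&` dF y <> set0;
        forall t : R, 0 < t < 1 ->
          t * F x + (1 - t) * F y = F (t *: x + (1 - t) *: y);
        exists2 t : R, 0 < t < 1 &
          t * F x + (1 - t) * F y = F (t *: x + (1 - t) *: y)]).
Proof.
split=> [|cX]; apply: subdifferential_tfae => //.
- by move=> u t v w; rewrite /dual_pairing linearP.
- by move=> z; exact: (dual_subdifferential_neq0 norm_ip F_lip F_convex).
- by move=> u t v w; rewrite linearP.
- move=> z; exact: (complete_subdifferential_neq0 norm_ip F_lip F_convex z cX).
Qed.
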